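(* Let $A$ and $B$ be two commuting hyperbolic $2\times 2$ matrices with expanding eigenvalues $\lambda_A$ and $\lambda_B$, respectively. Let $v_1,v_2$ be common eigenvectors of $A$ and $B$ forming a basis of $\mathbb{R}^2$, where $v_1$ corresponds to the expanding eigenvalues ($Av_1=\lambda_A v_1$, $Bv_1=\lambda_B v_1$) and $v_2$ corresponds to the contracting eigenvalues ($Av_2=\lambda_A^{-1}v_2$, $Bv_2=\lambda_B^{-1}v_2$). Let $T$ be the $\mathbb{Z}^2$-action on $\mathbb{T}^2=\mathbb{R}^2/\mathbb{Z}^2$ given by $T((m_1,m_2),x)=A^{m_1}B^{m_2}x$. Then for every $k\in\{1,2,3,4\}$, $$h_k(T)=\log|\lambda_A|+\log|\lambda_B|.$$
   Context: A hyperbolic matrix is an integer matrix of determinant one with distinct real eigenvalues, each of absolute value not equal to one. For a $2\times 2$ hyperbolic matrix, the eigenvalue $\lambda$ with $|\lambda|>1$ is its expanding eigenvalue, and the other, $1/\lambda$, is its contracting eigenvalue. Metric on the torus: let $\pi:\mathbb{R}^2\to\mathbb{T}^2$ be the quotient map. For $x,y\in\mathbb{R}^2$ write $x-y=a_1v_1+a_2v_2$ and put $\tilde\rho(x,y)=\max(|a_1|,|a_2|)$. This translation-invariant metric induces a (quotient) metric $\rho$ on $\mathbb{T}^2$ via $\pi$, which generates the usual topology of $\mathbb{T}^2$. A $\mathbb{Z}^d$-action on a compact metric space $(X,\rho)$ is a continuous map $T:\mathbb{Z}^d\times X\to X$ with $T^0(x)=x$ and $T^{m+m'}(x)=T^m(T^{m'}(x))$,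 where $T^m(x)=T(m,x)$. Order: for $k\in\{1,\dots,2^d\}$ let $k^b=(k_1^b,\dots,k_d^b)\in\{0,1\}^d$ be defined by $k-1=\sum_{i=1}^d k_i^b2^{i-1}$. For $x,y\in\mathbb{Z}^d$, $x>^k y$ means $(-1)^{k_i^b}x_i>(-1)^{k_i^b}y_i$ for all $i$; $x\ge^k y$ means $x>^k y$ or $x=y$. $k$-type metric: for a positive integer $n$, $\rho_{n,k}(x,y)=\max\{\rho(T^m(x),T^m(y)) : m\in\mathbb{Z}^d,\ m\ge^k 0,\ \|m\|<n\}$, where $\|m\|=\max_{1\le i\le d}|m_i|$. For $\epsilon>0$, $\operatorname{cov}(n,k,\epsilon,T)$ is the minimum cardinality of a collection of subsets of $X$ with union $X$, each of $\rho_{n,k}$-diameter less than $\epsilon$. $k$-type entropy: $h_k(T)=\lim_{\epsilon\to0^+}\limsup_{n\to\infty}\frac1n\log\operatorname{cov}(n,k,\epsilon,T)$. Here $d=2$. *)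

(* Defs.v *)
From HB Require Import structures.
From mathcomp Require Import all_boot all_order all_algebra.
From mathcomp Require Import all_classical all_reals all_analysis.
Import Order.TTheory GRing.Theory Num.Theory.
Import numFieldNormedType.Exports.

Set Implicit Arguments.
Unset Strict Implicit.
Unset Printing Implicit Defensive.

Local Open Scope classical_set_scope.
Local Open Scope ring_scope.
Local Open Scope quotient_scope.

Section Order.
Variable d : nat.
Implicit Types (k : nat) (i : 'I_d) (x y m : 'rV[int]_d).

(* The types k are numbered from 1 and coordinates from 0, so kbit k i is the
   binary digit of weight 2 ^ i of k - 1; see kbit_expansion. *)
Definition kbit k i : bool := odd (k.-1 %/ 2 ^ i).

Definition gtk k x y : Prop :=
  forall i, (-1) ^+ kbit k i * y ord0 i < (-1) ^+ kbit k i * x ord0 i.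

Definition gek k x y : Prop := gtk k x y \/ x = y.

Definition maxnorm m : nat := \max_(i < d) `|m ord0 i|%N.

Definition kbox n k : set 'rV[int]_d :=
  [set m | gek k m 0 /\ (maxnorm m < n)%N].

Lemma kbit_expansion k : (0 < k <= 2 ^ d)%N ->
  k.-1 = (\sum_(i < d) kbit k i * 2 ^ i)%N.
Proof.
case: k => //= k; rewrite /kbit /= => kd; elim: d k kd => [|e IH] k kd.
  by move: kd; rewrite big_ord0 expn0 ltnS leqn0 => /eqP.
rewrite big_ord_recl expn0 divn1 muln1 -[LHS]odd_double_half; congr addn.
have k2 : (k./2 < 2 ^ e)%N.
  by rewrite -divn2 ltn_divLR// -expnSr.
rewrite [in LHS](IH _ k2) -muln2 big_distrl /=; apply: eq_bigr => i _.
by rewrite /bump /= add1n -divn2 -divnMA -expnS -mulnA -expnSr.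
Qed.

Lemma finite_kbox n k : finite_set (kbox n k).
Proof.
pose f (g : {ffun 'I_d -> bool * 'I_n}) : 'rV[int]_d :=
  \row_i ((-1) ^+ (g i).1 * (g i).2%:Z).
apply: (@sub_finite_set _ _ (f @` setT)); last first.
  by apply: finite_image; exact: finite_finset.
move=> m [_ mn].
have lt_m i : (`|m ord0 i| < n)%N.
  by apply: leq_ltn_trans mn; exact: (@leq_bigmax _ (fun j : 'I_d => `|m ord0 j|%N)).
exists [ffun i => (m ord0 i < 0, Ordinal (lt_m i))] => //.
by apply/rowP => i; rewrite mxE ffunE /= -intEsign.
Qed.

End Order.

Section Entropy.
Variables (R : realType) (d : nat) (X : Type) (rho : X -> X -> R).
Variable T : 'rV[int]_d -> X -> X.

(* A maximum over a finite index set (finite_kbox). The default 0 is harmless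
   for a metric rho. *)
Definition rho_nk n k (x y : X) : R :=
  \big[Num.max/0]_(m \in kbox n k) rho (T m x) (T m y).

Definition diam (delta : X -> X -> R) (S : set X) : \bar R :=
  ereal_sup [set (delta p.1 p.2)%:E | p in S `*` S].

Definition small_cover n k (eps : R) (C : set (set X)) : Prop :=
  \bigcup_(S in C) S = setT /\
  (forall S, C S -> (diam (rho_nk n k) S < eps%:E)%E).

(* The minimum is taken in \bar R, so it is +oo when there is no finite such
   cover. *)
Definition cov n k (eps : R) : \bar R :=
  ereal_inf [set N%:R%:E | N in
    [set N : nat | exists C : set (set X), (C #= `I_N)%card /\ small_cover n k eps C]].

Definition entropy_at k (eps : R) : \bar R :=
  limn_esup (fun n : nat => (n%:R^-1)%:E * lne (cov n k eps))%E.

Definition entropy k : \bar R := lim (entropy_at k eps @[eps --> 0^'+]).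

Lemma entropy_is_cvg k : cvg (entropy_at k eps @[eps --> 0^'+]).
Proof.
apply: nonincreasing_at_right_is_cvge; near=> e => x y _ _ xy.
rewrite /entropy_at !limn_esup_lim; apply: lee_lim.
- exact: is_cvg_esups.
- exact: is_cvg_esups.
apply: nearW => n; rewrite /esups/= /sdrop; apply: ge_ereal_sup => _ [j nj <-].
apply: (@le_trans _ _ ((j%:R^-1)%:E * lne (cov j k x))%E); last first.
  by apply: ereal_sup_ubound; exists j.
apply: lee_wpmul2l; first by rewrite lee_fin.
have cov_ge0 z : (0 <= cov j k z)%E.
  by apply: le_ereal_inf_tmp => _ [N _ <-]; rewrite lee_fin.
have covxy : (cov j k y <= cov j k x)%E.
  apply: ereal_inf_le_tmp => _ [N [C [CN [CT Cx]]] <-]; exists N => //.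
  exists C; split => //; split => // S CS.
  by apply: lt_le_trans (Cx _ CS) _; rewrite lee_fin.
by rewrite lee_lne// in_itv/= leey andbT.
Unshelve. all: by end_near.
Qed.

End Entropy.

Section Torus.
Variables (R : realType) (n : nat).

Definition intmx (M : 'M[int]_n) : 'M[R]_n := map_mx intr M.

Definition int_lattice : {pred 'cV[R]_n} :=
  [pred x | x \is a mxOver Num.int].

Fact int_lattice_zmod_closed : zmod_closed int_lattice.
Proof.
split=> [|x y]; first by rewrite inE mxOver0.
rewrite !inE => /mxOverP xZ /mxOverP yZ; apply/mxOverP => i j.
by rewrite !mxE rpredB.
Qed.

HB.instance Definition _ :=
  GRing.isZmodClosed.Build 'cV[R]_n int_lattice int_lattice_zmod_closed.

(* Only the quotient of additive groups is used. *)
Definition torus := Quotient.quot int_lattice.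

(* Independent of the chosen representative; see toral_mapE. *)
Definition toral_map (M : 'M[int]_n) (p : torus) : torus :=
  \pi_torus (intmx M *m repr p).

Lemma intmx_lattice (M : 'M[int]_n) (x : 'cV[R]_n) :
  x \in int_lattice -> intmx M *m x \in int_lattice.
Proof.
rewrite !inE => /mxOverP xZ; apply/mxOverP => i j; rewrite mxE rpred_sum// => l _.
by rewrite mxE rpredM ?intr_int.
Qed.

Lemma toral_mapE (M : 'M[int]_n) (x : 'cV[R]_n) :
  toral_map M (\pi_torus x) = \pi_torus (intmx M *m x).
Proof.
apply/eqP; rewrite -Quotient.idealrBE -mulmxBr; apply: intmx_lattice.
by rewrite Quotient.idealrBE reprK.
Qed.

Lemma toral_mapM (M N : 'M[int]_n) (p : torus) :
  toral_map (M *m N) p = toral_map M (toral_map N p).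
Proof. by rewrite [toral_map N p]/toral_map toral_mapE mulmxA -map_mxM. Qed.

(* Having n distinct eigenvalues, s lists all of them.  The library predicate
   eigenvalue is phrased with row eigenvectors, which have the same eigenvalues
   as column eigenvectors. *)
Definition hyperbolic (M : 'M[int]_n) : Prop :=
  \det M = 1 /\
  exists s : n.-tuple R, uniq s /\
    {in s, forall a, eigenvalue (intmx M) a /\ `|a| != 1}.

Definition expanding_eigenvalue (M : 'M[int]_n) (a : R) : Prop :=
  eigenvalue (intmx M) a /\ 1 < `|a|.

End Torus.

Section TorusMetric.
Variables (R : realType) (v1 v2 : 'cV[R]_2).

Definition plane_dist (x y : 'cV[R]_2) : R :=
  Num.max `|coord [tuple v1; v2] 0 (x - y)| `|coord [tuple v1; v2] 1 (x - y)|.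

Definition torus_dist (p q : torus R 2) : R :=
  inf [set plane_dist z.1 z.2 | z in
    [set z | \pi_(torus R 2) z.1 = p /\ \pi_(torus R 2) z.2 = q]].

End TorusMetric.

(* A ^ i is the integer power exprz in the unit ring 'M[int]_2; A and B are
   units when they have determinant 1. *)
Definition toral_action (R : realType) (A B : 'M[int]_2) (m : 'rV[int]_2)
    (p : torus R 2) : torus R 2 :=
  toral_map (A ^ (m 0 0) * B ^ (m 0 1)) p.

Lemma toral_action0 (R : realType) (A B : 'M[int]_2) (p : torus R 2) :
  toral_action A B 0 p = p.
Proof.
rewrite /toral_action !mxE !expr0z mulr1 /toral_map /intmx.
by rewrite (map_mx1 intr) mul1mx reprK.
Qed.

Lemma toral_actionD (R : realType) (A B : 'M[int]_2) (m m' : 'rV[int]_2)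
    (p : torus R 2) :
  \det A = 1 -> \det B = 1 -> A *m B = B *m A ->
  toral_action A B (m + m') p = toral_action A B m (toral_action A B m' p).
Proof.
move=> dA dB AB.
have uA : A \is a GRing.unit by rewrite unitmxE dA unitr1.
have uB : B \is a GRing.unit by rewrite unitmxE dB unitr1.
rewrite /toral_action -toral_mapM !mxE !exprzDr//.
suff -> : A ^ m 0 0 * A ^ m' 0 0 * (B ^ m 0 1 * B ^ m' 0 1) =
  A ^ m 0 0 * B ^ m 0 1 * (A ^ m' 0 0 * B ^ m' 0 1) by [].
rewrite -!mulrA; congr (_ * _); rewrite !mulrA; congr (_ * _).
by apply: commrXz; apply/commr_sym/commrXz/commr_sym.
Qed.

(* Main.v *)
Require Import Defs.
From HB Require Import structures.
From mathcomp Require Import all_boot all_order all_algebra.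
From mathcomp Require Import all_classical all_reals all_analysis.
From mathcomp Require Import ring lra zify.
Import Order.TTheory GRing.Theory Num.Theory.
Import numFieldNormedType.Exports.

(* In the eigenbasis (v1, v2) the matrix A^i B^j acts as diag(f, 1/f) with
   f = lA^i lB^j.  Over the box of the points m >=^k 0 of norm < n, the product
   of the largest |f| and the largest 1/|f| is (|lA| |lB|)^n up to a bounded
   factor, for every k.  Covering a bounded parallelogram that projects onto the
   torus by rectangles of sides eps/max|f| and eps/max(1/|f|) bounds cov from
   above by a constant times (|lA| |lB|)^n.  Conversely, a rectangular grid with
   this spacing inside a parallelogram of side eps is separated: walking through
   the box one step at a time multiplies distances by at most |lA| |lB|, so the
   first time two orbits are eps apart they are still within the radius where the
   torus metric is the plane metric. *)

Local Open Scope classical_set_scope.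
Local Open Scope ring_scope.

Set Implicit Arguments.
Unset Strict Implicit.
Unset Printing Implicit Defensive.

Local Notation proj := (\pi_(torus _ 2)%qT).

(** * Maxima over finite sets *)

Section FiniteMaximum.
Variables (R : realType) (I : choiceType).
Implicit Types (D : set I) (F : I -> R).

Lemma fsbigmax_le D F (c : R) : finite_set D -> 0 <= c ->
  (forall i, D i -> F i <= c) -> \big[Num.max/0]_(i \in D) F i <= c.
Proof.
move=> fD c0 Fc; rewrite big_seq_cond; apply: bigmax_le => // i.
rewrite andbT in_finite_support; last exact: finite_setIl.
by move=> /set_mem[/Fc].
Qed.

Lemma le_fsbigmax D F (i : I) : finite_set D -> D i ->
  F i <= \big[Num.max/0]_(j \in D) F j.
Proof.
(* The iterated maximum ranges only over indices with [F i != 0]; an index of value 0 is covered by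
   the default 0. *)
move=> fD Di; have [Fi0|Fi0] := eqVneq (F i) 0.
  by rewrite Fi0; exact: bigmax_ge_id.
apply: (@le_bigmax_seq _ _ _ _ _ i xpredT) => //.
rewrite in_finite_support; last exact: finite_setIl.
by apply/mem_set; split => //; apply/eqP.
Qed.

End FiniteMaximum.

(** * Covering numbers: covers and separated points *)

Section CoveringNumber.
Variables (R : realType) (d : nat) (X : Type) (rho : X -> X -> R).
Variable T : 'rV[int]_d -> X -> X.
Implicit Types (n k M : nat) (eps : R) (x y : X).

Lemma le_rho_nk n k (m : 'rV[int]_d) x y :
  kbox n k m -> rho (T m x) (T m y) <= rho_nk rho T n k x y.
Proof.
exact: (@le_fsbigmax _ _ _ (fun m => rho (T m x) (T m y)) m (finite_kbox d n k)).
Qed.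

Lemma rho_nk_le n k x y eps : 0 <= eps ->
  (forall m, kbox n k m -> rho (T m x) (T m y) <= eps) ->
  rho_nk rho T n k x y <= eps.
Proof. exact: fsbigmax_le (finite_kbox d n k). Qed.

(** The sets [g i] may coincide, so the cover has some exact cardinality [N], which is at most
    [M]. *)
Lemma cov_le n k eps M (g : nat -> set X) :
  small_cover rho T n k eps (g @` `I_M) -> (cov rho T n k eps <= M%:R%:E)%E.
Proof.
move=> gC; have gM := card_image_le g `I_M.
have [N gN] : exists N, (g @` `I_M #= `I_N)%card.
  by apply/finite_setP/finite_image/finite_II.
apply: (@le_trans _ _ N%:R%:E).
  by apply: ereal_inf_lbound; exists N => //; exists (g @` `I_M).
by rewrite lee_fin ler_nat -card_le_II -(card_le_eql gN).
Qed.

(** Pigeonhole: a set of diameter less than [eps] contains at most one of the points, so sending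
    each point to a member of the cover that contains it is injective. *)
Lemma cov_ge n k eps M (x : nat -> X) :
  (forall i j, (i < M)%N -> (j < M)%N -> rho_nk rho T n k (x i) (x j) < eps ->
    i = j) ->
  (M%:R%:E <= cov rho T n k eps)%E.
Proof.
move=> sep; apply: le_ereal_inf_tmp => _ [N [C [CN [CT Cd]]] <-].
have /choice[S SP] (i : nat) : exists S, C S /\ S (x i).
  by have : setT (x i) by []; rewrite -CT => -[S]; exists S.
rewrite lee_fin ler_nat -card_le_II -(card_le_eqr CN).
have Sinj : {in `I_M &, injective S}.
  move=> i j /set_mem iM /set_mem jM Sij; apply: (sep _ _ iM jM).
  have [CSi Sxi] := SP i; have [_ Sxj] := SP j.
  rewrite -lte_fin; apply: le_lt_trans (Cd _ CSi); apply: ereal_sup_ubound.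
  by exists (x i, x j) => //; split => //; rewrite Sij.
rewrite -(card_le_eql (inj_card_eq Sinj)).
by apply: subset_card_le => _ [i _ <-]; have [] := SP i.
Qed.

End CoveringNumber.

(** * Eigenvector coordinates and the torus metric *)

Section EigenCoordinates.
Variables (R : realType) (v1 v2 : 'cV[R]_2).
Hypothesis basis_v : basis_of {: 'cV[R]_2}%VS [:: v1; v2].
Implicit Types (x y z : 'cV[R]_2) (p q : torus R 2).

Local Notation c1 := (coord [tuple v1; v2] 0).
Local Notation c2 := (coord [tuple v1; v2] 1).

Lemma coord_decomposition x : x = c1 x *: v1 + c2 x *: v2.
Proof.
rewrite {1}(coord_basis (X := [tuple v1; v2]) basis_v (memvf x)).
rewrite big_ord_recl big_ord1.
by have -> : lift ord0 ord0 = 1 :> 'I_2 by exact: val_inj.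
Qed.

Lemma coord_combination (a b : R) :
  c1 (a *: v1 + b *: v2) = a /\ c2 (a *: v1 + b *: v2) = b.
Proof.
have fv : free [tuple v1; v2] := basis_free basis_v.
have e1 i : coord [tuple v1; v2] i v1 = (0 == i)%:R by exact: (coord_free 0 i fv).
have e2 i : coord [tuple v1; v2] i v2 = (1 == i)%:R by exact: (coord_free 1 i fv).
by rewrite !linearD !linearZ /= !e1 !e2 !mulr1 !mulr0 addr0 add0r.
Qed.

Lemma plane_dist_lt x y (c : R) :
  (plane_dist v1 v2 x y < c) = (`|c1 (x - y)| < c) && (`|c2 (x - y)| < c).
Proof. exact: gt_max. Qed.

Lemma plane_dist_le x y (c : R) :
  (plane_dist v1 v2 x y <= c) = (`|c1 (x - y)| <= c) && (`|c2 (x - y)| <= c).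
Proof. exact: ge_max. Qed.

Lemma plane_dist_ge0 x y : 0 <= plane_dist v1 v2 x y.
Proof. by rewrite le_max normr_ge0. Qed.

(** A nonzero integer vector has an entry of absolute value at least 1, and every entry is at most
    [m] times the larger eigencoordinate in absolute value. *)
Lemma lattice_gap : exists2 del : R, 0 < del &
  forall z, z \in @int_lattice R 2 -> z != 0 -> del <= Num.max `|c1 z| `|c2 z|.
Proof.
pose m := 1 + \sum_i (`|v1 i 0| + `|v2 i 0|).
have m0 : 0 < m by rewrite ltr_wpDr// sumr_ge0// => i _; rewrite addr_ge0.
exists m^-1; first by rewrite invr_gt0.
move=> z; rewrite inE => /mxOverP zZ z0; set M := Num.max _ _.
have M0 : 0 <= M by rewrite le_max normr_ge0.
have [i zi] : exists i, z i 0 != 0.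
  apply/existsP; apply: contraNT z0 => /existsPn z0.
  by apply/eqP/matrixP => i j; rewrite ord1 mxE; apply/eqP; rewrite -[_ == _]negbK z0.
have z1 : 1 <= `|z i 0|.
  have := zZ i 0; move: zi => /[swap] /intrP[w ->].
  by rewrite intr_eq0 -intr_norm ler1z; lia.
rewrite -[_^-1]mul1r ler_pdivrMr//; apply: le_trans z1 _.
rewrite {1}[z]coord_decomposition !mxE; apply: le_trans (ler_normD _ _) _.
rewrite !normrM; apply: (@le_trans _ _ (M * `|v1 i 0| + M * `|v2 i 0|)).
  by apply: lerD; apply: ler_wpM2r; rewrite // le_max lexx ?orbT.
rewrite -mulrDr ler_wpM2l// /m (bigD1 i)//= addrCA lerDl addr_ge0// sumr_ge0//.
Qed.

Lemma torus_dist_le x y : torus_dist v1 v2 (proj x) (proj y) <= plane_dist v1 v2 x y.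
Proof.
apply: ge_inf; last by exists (x, y).
by exists 0 => _ [z _ <-]; exact: plane_dist_ge0.
Qed.

(** Other lifts change the difference by a lattice vector [l]. If [l] is nonzero, some coordinate
    moves by at least [del]; having started within [del / 2] of 0, it ends at least [del / 2] away.
    So the infimum is attained at the given lifts. *)
Lemma torus_dist_local : exists2 r : R, 0 < r & forall x y,
  plane_dist v1 v2 x y <= r ->
  torus_dist v1 v2 (proj x) (proj y) = plane_dist v1 v2 x y.
Proof.
have [del del0 gap] := lattice_gap; exists (del / 2); first by rewrite divr_gt0.
move=> x y xy; apply/eqP; rewrite eq_le torus_dist_le/=; apply: lb_le_inf.
  by exists (plane_dist v1 v2 x y); exists (x, y).
move=> _ [[x' y'] /= [/eqP xx' /eqP yy'] <-].
move: xx' yy'; rewrite -!Quotient.idealrBE => xx' yy'.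
pose l := (x' - y') - (x - y).
have lE : l = (x' - x) - (y' - y).
  by rewrite /l !opprB addrACA [RHS]addrACA [- y' - x]addrC.
have [l0|l0] := eqVneq l 0.
  by rewrite /plane_dist; move/eqP: l0; rewrite subr_eq0 => /eqP ->.
have lZ : l \in @int_lattice R 2 by rewrite lE rpredB.
have cl i : coord [tuple v1; v2] i l =
  coord [tuple v1; v2] i (x' - y') - coord [tuple v1; v2] i (x - y).
  exact: linearB.
move: xy (gap _ lZ l0); rewrite plane_dist_le /plane_dist !cl /=.
move: (c1 (x' - y')) (c2 (x' - y')) (c1 (x - y)) (c2 (x - y)) => a' b' a b.
have far (s s' : R) : `|s| <= del / 2 -> del <= `|s' - s| -> del / 2 <= `|s'|.
  by move=> sd; have := ler_normB s' s; lra.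
case/andP => ad bd; rewrite [del <= _]le_max => /orP[/(far _ _ ad)|/(far _ _ bd)] d2.
  by rewrite le_max !ge_max (le_trans ad d2) (le_trans bd d2).
by rewrite le_max !ge_max (le_trans ad d2) (le_trans bd d2) orbT.
Qed.

(** Removing integer parts leaves entries between 0 and 1, so the eigencoordinates are bounded
    through those of the standard basis vectors [e j]. *)
Lemma torus_bounded_representative : exists2 L : R, 0 < L &
  forall p, exists x, proj x = p /\ `|c1 x| <= L /\ `|c2 x| <= L.
Proof.
pose e (j : 'I_2) : 'cV[R]_2 := delta_mx j 0.
pose L : R := 1 + \sum_i \sum_j `|coord [tuple v1; v2] i (e j)|.
have L0 : 0 < L by rewrite ltr_wpDr// !sumr_ge0// => i _; rewrite sumr_ge0.
exists L => // p; pose x := repr p; pose w := \col_i ((Num.floor (x i 0))%:~R : R).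
have b i : `|coord [tuple v1; v2] i (x - w)| <= L.
  have -> : x - w = \sum_j (x - w) j 0 *: e j.
    rewrite [LHS]matrix_sum_delta; apply: eq_bigr => j _.
    by rewrite big_ord1.
  rewrite linear_sum; apply: le_trans (ler_norm_sum _ _ _) _.
  rewrite /L [X in 1 + X](bigD1 i)//= addrCA ler_wpDr//.
    by rewrite addr_ge0// !sumr_ge0// => i' _; rewrite sumr_ge0.
  apply: ler_sum => j _; rewrite linearZ normrM ler_piMl// !mxE.
  rewrite ger0_norm ?subr_ge0 ?floor_le// lerBlDr.
  by rewrite addrC -intrD1 ltW// floorD1_gt.
exists (x - w); split; last by split.
rewrite -[p]reprK; apply/eqP; rewrite -Quotient.idealrBE addrAC subrr sub0r rpredN.
by rewrite inE; apply/mxOverP => i j; rewrite mxE intr_int.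
Qed.

End EigenCoordinates.

(** * Exponential growth rates and powers on eigenvectors *)

(** Squeeze: the logarithm of [t * w ^+ n] divided by [n] is [ln t / n + ln w], so the constants [c]
    and [K] disappear in the limit. *)
Lemma cvg_log_rate (R : realType) (u : nat -> \bar R) (w c K : R) :
  0 < w -> 0 < c -> 0 < K ->
  (\forall n \near \oo, ((c * w ^+ n)%:E <= u n <= (K * w ^+ n)%:E)%E) ->
  ((n%:R^-1)%:E * lne (u n))%E @[n --> \oo] --> (ln w)%:E.
Proof.
move=> w0 c0 K0 uE.
have lim (t : R) : (n%:R^-1 * t + ln w)%:E @[n --> \oo] --> (ln w)%:E.
  apply: cvg_EFin; first by near=> n.
  rewrite -[X in _ --> X]add0r; apply: cvgD; last exact: cvg_cst.
  rewrite -(mul0r t); apply: cvgMl => /=.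
  apply/gtr0_cvgV0; first by near=> n; rewrite ltr0n; near: n; exact: nbhs_infty_gt.
  exact: cvgr_idn.
have lnE (t : R) n : 0 < t -> (0 < n)%N ->
    ((n%:R^-1)%:E * lne (t * w ^+ n)%:E = (n%:R^-1 * ln t + ln w)%:E)%E.
  move=> t0 n0; rewrite lne_EFin ?mulr_gt0 ?exprn_gt0//.
  rewrite lnM ?posrE ?exprn_gt0// lnXn// -EFinM mulrDr -[ln w *+ n]mulr_natl.
  by rewrite mulKf// pnatr_eq0 -lt0n.
apply: squeeze_cvge (lim (ln c)) (lim (ln K)).
near=> n.
have n0 : (0 < n)%N by near: n; exact: nbhs_infty_gt.
have /andP[cu uK] : ((c * w ^+ n)%:E <= u n <= (K * w ^+ n)%:E)%E by near: n.
have cw0 : (0 <= (c * w ^+ n)%:E)%E by rewrite lee_fin mulr_ge0 ?exprn_ge0// ltW.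
have u0 : (0 <= u n)%E := le_trans cw0 cu.
have n1 : (0 <= (n%:R^-1 : R)%:E)%E by rewrite lee_fin.
rewrite -!lnE// !(lee_wpmul2l n1) ?lee_lne ?in_itv/= ?leey ?andbT//.
exact: le_trans uK.
Unshelve. all: by end_near. Qed.

Lemma mulmx_eigen_expz (F : fieldType) (n : nat) (N : 'M[F]_n.+1)
    (v : 'cV[F]_n.+1) (l : F) (z : int) :
  N \is a GRing.unit -> l != 0 -> N *m v = l *: v -> N ^ z *m v = l ^ z *: v.
Proof.
move=> uN l0 Nv.
have pos (j : nat) : N ^+ j *m v = l ^+ j *: v.
  elim: j => [|j IH]; first by rewrite !expr0 mul1mx scale1r.
  by rewrite !exprS -mulmxA IH -scalemxAr Nv scalerA mulrC.
case: z => j; first exact: pos.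
(* Here the exponent is [-(j + 1)]; multiplying by [l ^+ j.+1] reduces the claim to the positive
   power [pos]. *)
apply: (scalerI (expf_neq0 j.+1 l0)); rewrite scalerA mulfV ?expf_neq0// scale1r.
rewrite scalemxAr -pos mulmxA -[LHS]/((N ^+ j.+1)^-1 * N ^+ j.+1 *m v).
by rewrite mulVr ?unitrX// mul1mx.
Qed.

(** * Grids and cells on a line *)

(** Indices stop at the integer part of [c], so a grid of spacing [eps / c] has width at most [eps];
    stretched by [c], its spacing becomes [eps], which separates distinct points. *)
Lemma grid_spacing (R : realType) (eps c : R) (i j : nat) : 0 < eps -> 0 < c ->
  (i < (Num.truncn c).+1)%N -> (j < (Num.truncn c).+1)%N ->
  `|i%:R * (eps / c) - j%:R * (eps / c)| <= eps /\
  (c * `|i%:R * (eps / c) - j%:R * (eps / c)| < eps -> i = j).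
Proof.
move=> eps0 c0 iP jP; rewrite -mulrBl normrM (gtr0_norm (divr_gt0 eps0 c0)).
have tc : (Num.truncn c)%:R <= c by have /andP[] := truncn_itv (ltW c0).
have ic : i%:R <= c by apply: le_trans tc; rewrite ler_nat.
have jc : j%:R <= c by apply: le_trans tc; rewrite ler_nat.
split.
  rewrite mulrA ler_pdivrMr// mulrC (ler_wpM2l (ltW eps0))// ler_norml.
  by have := ler0n R i; have := ler0n R j; lra.
have -> : c * (`|i%:R - j%:R| * (eps / c)) = `|i%:R - j%:R| * eps.
  by field; rewrite gt_eqF.
rewrite gtr_pMl// ltr_norml => /andP[ji ij].
have ij' : (i < j.+1)%N by rewrite -(ltr_nat R) -natr1; lra.
have ji' : (j < i.+1)%N by rewrite -(ltr_nat R) -natr1; lra.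
by apply/eqP; rewrite eqn_leq -ltnS ij' -ltnS ji'.
Qed.

Section Cells.
Variables (R : realType) (L eps c : R).
Hypotheses (L0 : 0 < L) (eps0 : 0 < eps).
Implicit Types t : R.

(** Cells have length [eps / (2 * c)] and start at [-L], so the last index on [[-L, L]] is the
    integer part of [2 * L] over that length. *)
Lemma cell_count t : 1 <= c -> `|t| <= L ->
  (Num.truncn ((t + L) * (2 * c / eps)) < (Num.truncn (4 * L * c / eps)).+1)%N.
Proof.
move=> c1; rewrite ler_norml => /andP[t1 t2]; rewrite ltnS le_truncn//.
have -> : 4 * L * c / eps = (L + L) * (2 * c / eps) by field; rewrite gt_eqF.
by rewrite ler_wpM2r ?divr_ge0 ?(ltW eps0)//; lra.
Qed.

(** Stretching by [c] turns the cell length into [eps / 2]; the half leaves room for the strict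
    diameter bound of a cover. *)
Lemma cell_close t t' : 0 < c -> `|t| <= L -> `|t'| <= L ->
  Num.truncn ((t + L) * (2 * c / eps)) = Num.truncn ((t' + L) * (2 * c / eps)) ->
  c * `|t - t'| <= eps / 2.
Proof.
move=> c0; have u0 : 0 < 2 * c / eps by rewrite divr_gt0// mulr_gt0.
rewrite !ler_norml => /andP[tl tu] /andP[t'l t'u] tt'.
have /truncn_itv : 0 <= (t + L) * (2 * c / eps) by rewrite mulr_ge0 ?(ltW u0)//; lra.
have /truncn_itv : 0 <= (t' + L) * (2 * c / eps) by rewrite mulr_ge0 ?(ltW u0)//; lra.
rewrite tt' -natr1 => /andP[t1 t2] /andP[t'1 t'2].
have -> : c * `|t - t'| =
    `|(t + L) * (2 * c / eps) - (t' + L) * (2 * c / eps)| * (eps / 2).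
  rewrite -mulrBl normrM (gtr0_norm u0) opprD addrACA subrr addr0.
  by field; rewrite gt_eqF.
by rewrite ler_piMl ?divr_ge0 ?(ltW eps0)// ler_norml; apply/andP; split; lra.
Qed.

(** The extra cell due to rounding is absorbed into a multiple of [c] because [1 <= c]. *)
Lemma cell_total : 1 <= c ->
  (Num.truncn (4 * L * c / eps)).+1%:R <= (4 * L / eps + 1) * c.
Proof.
move=> c1; have /truncn_itv/andP[+ _] : 0 <= 4 * L * c / eps.
  by rewrite divr_ge0 ?mulr_ge0 ?(ltW eps0) ?(ltW L0)//; lra.
have -> : (4 * L / eps + 1) * c = 4 * L * c / eps + c by field; rewrite gt_eqF.
by rewrite -[X in _ -> X <= _]natr1; lra.
Qed.

End Cells.

(** * Boxes of type [k] *)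

(** The order is strict in every coordinate, so a box contains no point of the axes other than the
    origin. The walk therefore starts with the diagonal step to (1, 1), then raises [h1], then
    [h0]. *)
Lemma box_walk_ind n (P : nat -> nat -> Prop) :
  P 0%N 0%N ->
  (forall h0 h1 h0' h1', (h0 <= h0' <= h0.+1)%N -> (h1 <= h1' <= h1.+1)%N ->
    (0 < h0' < n)%N -> (0 < h1' < n)%N -> P h0 h1 -> P h0' h1') ->
  forall h0 h1, (0 < h0 < n)%N -> (0 < h1 < n)%N -> P h0 h1.
Proof.
move=> P0 step; have row1 h1 : (1 < n)%N -> (0 < h1 < n)%N -> P 1%N h1.
  elim: h1 => // -[_|h1 IH] n1 h1n; first exact: (step 0%N 0%N).
  by apply: (step 1%N h1.+1) => //; [lia|apply: IH; lia].
elim=> // -[_|h0 IH] h1 h0n h1n; first by apply: row1; lia.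
by apply: (step h0.+1 h1) => //; [lia|lia|apply: IH; lia].
Qed.

Section OrderedBoxes.
Variable k : nat.

(** The signs depend on [k] alone, so all four orthants share one parametrisation by natural
    numbers. *)
Definition kpoint (h0 h1 : nat) : 'rV[int]_2 :=
  \row_i ((-1) ^+ kbit k i * (if i == 0 then h0 else h1)%:Z).

Lemma kbox_kpoint n h0 h1 : (0 < h0 < n)%N -> (0 < h1 < n)%N ->
  kbox n k (kpoint h0 h1).
Proof.
move=> h0n h1n; split.
  left=> i; rewrite !mxE mulr0 mulrA -expr2 sqrr_sign mul1r.
  by case: ifP => _; rewrite ltz_nat; lia.
rewrite /maxnorm !big_ord_recl big_ord0 !mxE !abszM !abszX /=; rewrite !exp1n; lia.
Qed.

Lemma kboxP n (m : 'rV[int]_2) : kbox n k m -> m = 0 \/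
  exists h0 h1, [/\ (0 < h0 < n)%N, (0 < h1 < n)%N & m = kpoint h0 h1].
Proof.
case=> -[mk|->]; last by left.
move=> mn; right; exists `|m 0%R 0%R|%N, `|m 0%R 1%R|%N.
have pos i : 0 < (-1) ^+ kbit k i * m ord0 i by have := mk i; rewrite mxE mulr0.
have lt i : (0 < `|m ord0 i| < n)%N.
  apply/andP; split; last first.
    by apply: leq_ltn_trans mn; exact: (@leq_bigmax _ (fun j : 'I_2 => `|m ord0 j|%N)).
  by rewrite absz_gt0; apply: contraTneq (pos i) => ->; rewrite mulr0 ltxx.
split; [exact: lt|exact: lt|].
have absE i : m ord0 i = (-1) ^+ kbit k i * `|m ord0 i|%N%:Z.
  by have := pos i; case: (kbit k i); rewrite /= ?mul1r ?mulN1r; lia.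
apply/rowP => i; rewrite [LHS]absE mxE; congr (_ * _).
by case: i => -[|[|//]] ilt /=; do ?congr (Posz (absz (m _ _))); apply: val_inj.
Qed.

End OrderedBoxes.

(** * Powers with a signed exponent *)

Section SignedPower.
Variable R : realType.
Implicit Types (s : bool) (a : R) (h n : nat).

Definition signed_power s a h : R := if s then (a ^+ h)^-1 else a ^+ h.

Lemma signed_powerE s a h : a ^ ((-1) ^+ s * h%:Z) = signed_power s a h.
Proof. by case: s; rewrite ?expr1 ?expr0 ?mulN1r ?mul1r// -exprnN. Qed.

Lemma signed_powerN s a h : signed_power (~~ s) a h = (signed_power s a h)^-1.
Proof. by case: s => //=; rewrite invrK. Qed.

Lemma signed_power_gt0 s a h : 0 < a -> 0 < signed_power s a h.
Proof. by move=> a0; case: s; rewrite /= ?invr_gt0 exprn_gt0. Qed.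

(** Since [h <= h'], a negative exponent only shrinks the power; the factor [a] makes the bound
    common to both signs. *)
Lemma signed_power_le_step s a h h' : 1 <= a -> (h <= h' <= h.+1)%N ->
  signed_power s a h' <= a * signed_power s a h.
Proof.
move=> a1 hh'; have a0 : 0 < a by exact: lt_le_trans a1.
case: s => /=; last by rewrite -exprS ler_weXn2l//; case/andP: hh'.
apply: (@le_trans _ _ (a ^+ h)^-1); last by rewrite ler_peMl// invr_ge0 exprn_ge0// ltW.
by rewrite lef_pV2 ?posrE ?exprn_gt0// ler_weXn2l//; case/andP: hh'.
Qed.

Lemma signed_power_le s a h n : 1 <= a -> (h <= n)%N ->
  signed_power s a h <= if s then 1 else a ^+ n.
Proof.
move=> a1 hn; case: s => /=; last exact: ler_weXn2l.
by rewrite invf_le1 ?exprn_ege1// exprn_gt0// (lt_le_trans _ a1).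
Qed.

End SignedPower.

(** * The action in eigencoordinates *)

Section TwoCoordinates.
Variables (R : realType) (A B : 'M[int]_2) (lA lB : R) (v1 v2 : 'cV[R]_2).
Hypothesis basis_v : basis_of {: 'cV[R]_2}%VS [:: v1; v2].
Hypotheses (detA : \det A = 1) (detB : \det B = 1).
Hypotheses (lA1 : 1 < `|lA|) (lB1 : 1 < `|lB|).
Hypotheses (Av1 : intmx R A *m v1 = lA *: v1) (Bv1 : intmx R B *m v1 = lB *: v1).
Hypotheses (Av2 : intmx R A *m v2 = lA^-1 *: v2)
  (Bv2 : intmx R B *m v2 = lB^-1 *: v2).
Implicit Types (m : 'rV[int]_2) (x y : 'cV[R]_2) (n k h : nat) (eps : R).

Local Notation c1 := (coord [tuple v1; v2] 0).
Local Notation c2 := (coord [tuple v1; v2] 1).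
Local Notation dist := (torus_dist v1 v2).
Local Notation T := (@toral_action R A B).

Let a : R := `|lA|.
Let b : R := `|lB|.
Let a1 : 1 <= a. Proof. exact: ltW. Qed.
Let b1 : 1 <= b. Proof. exact: ltW. Qed.
Let a0 : 0 < a. Proof. exact: lt_trans lA1. Qed.
Let b0 : 0 < b. Proof. exact: lt_trans lB1. Qed.

(** The eigenvalue of [action_mx m] on [v1]; its inverse is the eigenvalue on [v2]. *)
Definition dilation m : R := lA ^ m 0 0 * lB ^ m 0 1.

Definition action_mx m : 'M[R]_2 := intmx R (A ^ m 0 0 * B ^ m 0 1).

Lemma toral_action_proj m x : T m (proj x) = proj (action_mx m *m x).
Proof. exact: toral_mapE. Qed.

(** Determinant 1 makes [A] and [B] invertible over the integers, so negative powers also commute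
    with the passage to real entries and act diagonally on the eigenbasis. *)
Lemma coord_action m x : c1 (action_mx m *m x) = dilation m * c1 x /\
  c2 (action_mx m *m x) = (dilation m)^-1 * c2 x.
Proof.
have lA0 : lA != 0 by rewrite -normr_gt0.
have lB0 : lB != 0 by rewrite -normr_gt0.
have uA : A \is a GRing.unit by rewrite unitmxE detA unitr1.
have uB : B \is a GRing.unit by rewrite unitmxE detB unitr1.
have actE : action_mx m = intmx R A ^ m 0 0 *m intmx R B ^ m 0 1.
  rewrite /action_mx /intmx map_mxM; congr (_ *m _).
    exact: (rmorphXz (map_mx intr) _ uA).
  exact: (rmorphXz (map_mx intr) _ uB).
have uA' : intmx R A \is a GRing.unit by exact: (rmorph_unit (map_mx intr)).
have uB' : intmx R B \is a GRing.unit by exact: (rmorph_unit (map_mx intr)).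
suff -> : action_mx m *m x =
    (dilation m * c1 x) *: v1 + ((dilation m)^-1 * c2 x) *: v2.
  exact: coord_combination.
rewrite {1}[x](coord_decomposition basis_v) mulmxDr -!scalemxAr actE -!mulmxA.
rewrite (mulmx_eigen_expz _ uB' lB0 Bv1) -scalemxAr.
rewrite (mulmx_eigen_expz _ uA' lA0 Av1).
rewrite (mulmx_eigen_expz _ uB' _ Bv2) ?invr_eq0// -scalemxAr.
rewrite (mulmx_eigen_expz _ uA' _ Av2) ?invr_eq0// !scalerA -!expfV.
rewrite /dilation invfM; congr (_ *: _ + _ *: _).
  by rewrite -[LHS]mulrA [RHS]mulrC; congr (_ * _); exact: mulrC.
by rewrite -[LHS]mulrA [RHS]mulrC; congr (_ * _); exact: mulrC.
Qed.

Lemma norm_dilation k h0 h1 : `|dilation (kpoint k h0 h1)| =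
  signed_power (kbit k (0 : 'I_2)) a h0 * signed_power (kbit k (1 : 'I_2)) b h1.
Proof.
have nz z (l : R) : `|l ^ z| = `|l| ^ z by case: z => j /=; rewrite ?normfV normrX.
by rewrite normrM !nz !mxE/= !signed_powerE.
Qed.

(** Inversion flips both signs: the second coordinate is stretched as the first one would be in the
    opposite orthant. *)
Lemma norm_dilation_inv k h0 h1 : `|dilation (kpoint k h0 h1)|^-1 =
  signed_power (~~ kbit k (0 : 'I_2)) a h0 * signed_power (~~ kbit k (1 : 'I_2)) b h1.
Proof. by rewrite norm_dilation invfM !signed_powerN. Qed.

Lemma dilation_gt0 m : 0 < `|dilation m|.
Proof. by rewrite normr_gt0 mulf_neq0 ?expfz_neq0// -normr_gt0. Qed.

Lemma plane_dist_action m x y (c : R) :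
  (plane_dist v1 v2 (action_mx m *m x) (action_mx m *m y) < c) =
  (`|dilation m| * `|c1 (x - y)| < c) && (`|dilation m|^-1 * `|c2 (x - y)| < c).
Proof.
have [e1 e2] := coord_action m (x - y).
by rewrite plane_dist_lt -mulmxBr e1 e2 !(normrM _ (coord _ _ _)) normfV.
Qed.

Lemma plane_dist_action_le m x y (c : R) :
  (plane_dist v1 v2 (action_mx m *m x) (action_mx m *m y) <= c) =
  (`|dilation m| * `|c1 (x - y)| <= c) && (`|dilation m|^-1 * `|c2 (x - y)| <= c).
Proof.
have [e1 e2] := coord_action m (x - y).
by rewrite plane_dist_le -mulmxBr e1 e2 !(normrM _ (coord _ _ _)) normfV.
Qed.

Lemma dilation_step k h0 h1 h0' h1' :
  (h0 <= h0' <= h0.+1)%N -> (h1 <= h1' <= h1.+1)%N ->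
  `|dilation (kpoint k h0' h1')| <= a * b * `|dilation (kpoint k h0 h1)| /\
  `|dilation (kpoint k h0' h1')|^-1 <= a * b * `|dilation (kpoint k h0 h1)|^-1.
Proof.
move=> H0 H1; rewrite !norm_dilation_inv !norm_dilation; split.
  by rewrite mulrACA ler_pM ?signed_power_le_step ?ltW ?signed_power_gt0.
by rewrite mulrACA ler_pM ?signed_power_le_step ?ltW ?signed_power_gt0.
Qed.

(* Each step in the box changes the plane distance by a factor at most [a * b],
   so an orbit cannot jump from distance [eps] past the radius [r] below which
   the torus distance is the plane distance. *)
Lemma bowen_ball_local : exists2 e0 : R, 0 < e0 &
  forall eps, 0 < eps -> eps <= e0 -> forall n k x y,
  `|c1 (x - y)| <= eps -> `|c2 (x - y)| <= eps ->
  rho_nk dist T n k (proj x) (proj y) < eps ->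
  forall h0 h1, (0 < h0 < n)%N -> (0 < h1 < n)%N ->
  plane_dist v1 v2 (action_mx (kpoint k h0 h1) *m x)
    (action_mx (kpoint k h0 h1) *m y) < eps.
Proof.
have [r r0 local] := torus_dist_local basis_v.
have ab0 : 0 < a * b by rewrite mulr_gt0.
(* One step sends a distance at most [eps] to at most [a * b * eps], which must stay within [r]. *)
exists (r / (a * b)); first by rewrite divr_gt0.
move=> eps eps0 epsr n k x y x1 x2 rho.
pose D h0 h1 := plane_dist v1 v2 (action_mx (kpoint k h0 h1) *m x)
    (action_mx (kpoint k h0 h1) *m y).
(* The new plane distance is at most [r], hence equals the torus distance, which the orbit metric
   bounds strictly by [eps]. *)
have step h0 h1 h0' h1' : (h0 <= h0' <= h0.+1)%N -> (h1 <= h1' <= h1.+1)%N ->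
    (0 < h0' < n)%N -> (0 < h1' < n)%N -> D h0 h1 <= eps -> D h0' h1' < eps.
  move=> H0 H1 n0 n1; rewrite plane_dist_action_le => /andP[D1 D2].
  have mk : kbox n k (kpoint k h0' h1') by exact: kbox_kpoint.
  have : D h0' h1' <= r.
    have [d1 d2] := dilation_step k H0 H1.
    have ber : a * b * eps <= r by rewrite mulrC -ler_pdivlMr.
    rewrite plane_dist_action_le !(le_trans _ ber)//.
      apply: le_trans (ler_wpM2r (normr_ge0 _) d2) _.
      by rewrite -(mulrA (a * b)) ler_wpM2l// ltW.
    apply: le_trans (ler_wpM2r (normr_ge0 _) d1) _.
    by rewrite -(mulrA (a * b)) ler_wpM2l// ltW.
  move=> /local Dlocal; rewrite /D -Dlocal; apply: le_lt_trans rho.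
  rewrite -!toral_action_proj.
  exact: le_rho_nk.
have D00 : D 0%N 0%N <= eps.
  rewrite plane_dist_action_le norm_dilation_inv norm_dilation.
  by rewrite /signed_power !expr0 invr1 !if_same !mul1r x1.
have Dle : forall h0 h1, (0 < h0 < n)%N -> (0 < h1 < n)%N -> D h0 h1 <= eps.
  apply: (@box_walk_ind n (fun h0 h1 => D h0 h1 <= eps) D00).
  by move=> h0 h1 h0' h1' H0 H1 n0 n1 Dh; exact: ltW (step _ _ _ _ H0 H1 n0 n1 Dh).
(* A step of zero length is allowed; it turns the weak bound carried along the walk into a strict
   one. *)
have here h : (h <= h <= h.+1)%N by rewrite leqnn leqnSn.
move=> h0 h1 n0 n1.
exact: (step _ _ _ _ (here h0) (here h1) n0 n1 (Dle _ _ n0 n1)).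
Qed.

(** * Bounds for the covering number *)

(** Two near-extremal points of the box, one for each eigendirection, separate a grid of [P * Q]
    points. *)
Lemma cov_lower_bound : exists2 e0 : R, 0 < e0 &
  forall eps, 0 < eps -> eps <= e0 -> forall n k, (1 < n)%N ->
  (((a * b) ^- 2 * (a * b) ^+ n)%:E <= cov dist T n k eps)%E.
Proof.
have [e0 e00 bowen] := bowen_ball_local; exists e0 => // eps eps0 epse0 n k n1.
pose s0 := kbit k (0 : 'I_2); pose s1 := kbit k (1 : 'I_2).
(* Expanding exponents take the largest size [n - 1], contracting ones the smallest, 1. Over the two
   directions each base [c] contributes [c ^ (n - 2)], whence the factor [(a * b) ^- 2]. *)
pose hi (s : bool) := if s then 1%N else n.-1.
have hin (s : bool) : (0 < hi s < n)%N.
  by case: s; rewrite /hi/= ?n1// -subn1 subn_gt0 n1 ltn_subrL (ltnW n1).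
pose m := kpoint k (hi s0) (hi s1); pose m' := kpoint k (hi (~~ s0)) (hi (~~ s1)).
pose al := `|dilation m|; pose be := `|dilation m'|^-1.
have al0 : 0 < al by exact: dilation_gt0.
have be0 : 0 < be by rewrite invr_gt0 dilation_gt0.
have -> : (a * b) ^- 2 * (a * b) ^+ n = al * be.
  have sE (s : bool) (c : R) : 0 < c ->
      signed_power s c (hi s) * signed_power (~~ s) c (hi (~~ s)) = c ^- 2 * c ^+ n.
    move=> c0; have -> : c ^+ n = c ^+ n.-1 * c by rewrite -exprSr prednK// ltnW.
    rewrite /signed_power /hi; case: s => /=; move: (c ^+ n.-1) => X; rewrite expr1.
      by field; rewrite gt_eqF.
    by field; rewrite gt_eqF.
  rewrite /al /be norm_dilation norm_dilation_inv mulrACA !sE// !exprMn invfM.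
  by rewrite mulrACA.
pose P := (Num.truncn al).+1; pose Q := (Num.truncn be).+1.
(* Quotient and remainder by [Q] number the grid by a single index. *)
pose pt r := ((r %/ Q)%:R * (eps / al)) *: v1 + ((r %% Q)%:R * (eps / be)) *: v2.
apply: (@le_trans _ _ (P * Q)%N%:R%:E).
  by rewrite lee_fin natrM ler_pM ?ltW// ?ltW// truncnS_gt.
apply: (@cov_ge _ _ _ _ _ _ _ _ _ (proj \o pt)) => i j iPQ jPQ rho.
have ltQ r : (r %% Q < Q)%N by rewrite ltn_mod.
have ltP r : (r < P * Q)%N -> (r %/ Q < P)%N by move=> rPQ; rewrite ltn_divLR.
have [c1E c2E] :
    c1 (pt i - pt j) = (i %/ Q)%:R * (eps / al) - (j %/ Q)%:R * (eps / al) /\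
    c2 (pt i - pt j) = (i %% Q)%:R * (eps / be) - (j %% Q)%:R * (eps / be).
  rewrite !linearB /=; have [-> ->] := coord_combination basis_v
    ((i %/ Q)%:R * (eps / al)) ((i %% Q)%:R * (eps / be)).
  by have [-> ->] := coord_combination basis_v
    ((j %/ Q)%:R * (eps / al)) ((j %% Q)%:R * (eps / be)).
have [D1 S1] := grid_spacing eps0 al0 (ltP _ iPQ) (ltP _ jPQ).
have [D2 S2] := grid_spacing eps0 be0 (ltQ i) (ltQ j).
rewrite -c1E in D1 S1; rewrite -c2E in D2 S2.
have near_orbit := bowen _ eps0 epse0 n k _ _ D1 D2 rho.
(* At [m] the first coordinate is stretched by [al], which forces equal quotients; at [m'] the
   second is stretched by [be], which forces equal remainders. *)
have := near_orbit _ _ (hin s0) (hin s1); rewrite plane_dist_action => /andP[/S1 e1 _].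
have := near_orbit _ _ (hin (~~ s0)) (hin (~~ s1)).
rewrite plane_dist_action => /andP[_ /S2 e2].
by rewrite (divn_eq i Q) (divn_eq j Q) e1 e2.
Qed.

Lemma cov_upper_bound : exists2 L : R, 0 < L &
  forall eps, 0 < eps -> forall n k,
  (cov dist T n k eps <= ((L / eps + 1) ^+ 2 * (a * b) ^+ n)%:E)%E.
Proof.
have [L L0 repL] := torus_bounded_representative v1 v2.
(* With this constant, [cell_total] gives one factor [4 * L / eps + 1] per coordinate. *)
exists (4 * L); first by rewrite mulr_gt0.
move=> eps eps0 n k.
pose s0 := kbit k (0 : 'I_2); pose s1 := kbit k (1 : 'I_2).
(* Each base puts its [n]-th power into exactly one of [al] and [be], so their product is
   [(a * b) ^+ n] whatever the signs. *)
pose hi (s : bool) (c : R) := if s then 1 else c ^+ n.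
have hi1 s c : 1 <= c -> 1 <= hi s c.
  by move=> c1; rewrite /hi; case: s => //; exact: exprn_ege1.
pose al := hi s0 a * hi s1 b; pose be := hi (~~ s0) a * hi (~~ s1) b.
have al1 : 1 <= al by rewrite -[1]mulr1 ler_pM ?hi1.
have be1 : 1 <= be by rewrite -[1]mulr1 ler_pM ?hi1.
have albe : al * be = (a * b) ^+ n.
  rewrite /al /be /hi exprMn mulrACA.
  by case: (s0); case: (s1); rewrite /= ?mul1r ?mulr1.
have boxle m : kbox n k m -> `|dilation m| <= al /\ `|dilation m|^-1 <= be.
  case/kboxP=> [->|[h0 [h1 [/andP[_ /ltnW h0n] /andP[_ /ltnW h1n] ->]]]].
    by rewrite /dilation !mxE !expr0z mulr1 normr1 invr1.
  rewrite norm_dilation_inv norm_dilation; split.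
    by rewrite ler_pM ?signed_power_le// ltW// signed_power_gt0.
  by rewrite ler_pM ?signed_power_le// ltW// signed_power_gt0.
pose cell (c t : R) := Num.truncn ((t + L) * (2 * c / eps)).
pose width (c : R) := (Num.truncn (4 * L * c / eps)).+1.
have cell_lt c t : 1 <= c -> `|t| <= L -> (cell c t < width c)%N.
  by move=> c1 tL; exact: cell_count.
have close c t t' : 1 <= c -> `|t| <= L -> `|t'| <= L -> cell c t = cell c t' ->
    c * `|t - t'| <= eps / 2.
  by move=> c1; apply: cell_close => //; exact: lt_le_trans c1.
pose P := width al; pose Q := width be.
pose g (r : nat) : set (torus R 2) := proj @` [set x |
  [/\ `|c1 x| <= L, `|c2 x| <= L,
      cell al (c1 x) = (r %/ Q)%N & cell be (c2 x) = (r %% Q)%N]].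
apply: (@le_trans _ _ (P * Q)%N%:R%:E); last first.
  have wle c : 1 <= c -> (width c)%:R <= (4 * L / eps + 1) * c.
    by move=> c1; exact: cell_total.
  rewrite lee_fin natrM -albe expr2 mulrACA.
  by rewrite ler_pM// wle.
apply: (@cov_le _ _ _ _ _ _ _ _ _ g); split.
  apply/seteqP; split => // p _; have [x [<- [x1 x2]]] := repL p.
  pose i := cell al (c1 x); pose j := cell be (c2 x).
  have iP : (i < P)%N by exact: cell_lt.
  have jQ : (j < Q)%N by exact: cell_lt.
  exists (g (i * Q + j)%N).
    exists (i * Q + j)%N => //=; apply: (@leq_trans (i.+1 * Q)).
      by rewrite mulSn addnC ltn_add2r.
    by rewrite leq_mul2r iP orbT.
  exists x => //; split => //; first by rewrite divnMDl// divn_small ?addn0.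
  by rewrite modnMDl modn_small.
move=> _ [r _ <-]; apply: (@le_lt_trans _ _ (eps / 2)%:E); last first.
  by rewrite lte_fin; lra.
apply: ge_ereal_sup => _ [[p q] [/= [x [x1 x2 xP xQ] <-] [y [y1 y2 yP yQ] <-]] <-].
rewrite lee_fin; apply: rho_nk_le; first by rewrite divr_ge0// ltW.
move=> m mk; rewrite !toral_action_proj; apply: le_trans (torus_dist_le _ _ _ _) _.
have [d1 d2] := boxle _ mk.
rewrite plane_dist_action_le !linearB/=; apply/andP; split.
  apply: le_trans (ler_wpM2r (normr_ge0 _) d1) _.
  by apply: close => //; rewrite xP yP.
apply: le_trans (ler_wpM2r (normr_ge0 _) d2) _.
by apply: close => //; rewrite xQ yQ.
Qed.

(** * The entropy *)

(** For fixed small [eps] both bounds are constants times [(a * b) ^+ n], so the growth rate is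
    already [ln (a * b)] and the limit in [eps] is that of a locally constant function. *)
Lemma entropy_toral_action k : entropy dist T k = (ln `|lA| + ln `|lB|)%:E.
Proof.
have [e0 e00 lower] := cov_lower_bound; have [L L0 upper] := cov_upper_bound.
have ab0 : 0 < a * b by rewrite mulr_gt0.
apply: cvg_lim => //; apply: cvg_near_cst; near=> eps.
have eps0 : 0 < eps by near: eps; exact: nbhs_right_gt.
have epse0 : eps <= e0 by near: eps; exact: nbhs_right_le.
(* The sequence has a genuine limit, so its upper limit has the same value. *)
rewrite -lnM ?posrE//; apply: (cvg_limn_einf_sup _).2.
apply: (@cvg_log_rate _ _ _ ((a * b) ^- 2) ((L / eps + 1) ^+ 2)) => //.
- by rewrite invr_gt0 exprn_gt0.
- by rewrite exprn_gt0// addr_gt0// divr_gt0.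
near=> n; have n1 : (1 < n)%N by near: n; exact: nbhs_infty_gt.
by rewrite lower// upper.
Unshelve. all: by end_near. Qed.

End TwoCoordinates.

Theorem theorem7 (R : realType) (A B : 'M[int]_2) (lA lB : R)
    (v1 v2 : 'cV[R]_2)
    (hypA : hyperbolic R A) (hypB : hyperbolic R B)
    (commAB : A *m B = B *m A)
    (explA : expanding_eigenvalue A lA) (explB : expanding_eigenvalue B lB)
    (basis_v : basis_of {: 'cV[R]_2}%VS [:: v1; v2])
    (Av1 : intmx R A *m v1 = lA *: v1) (Bv1 : intmx R B *m v1 = lB *: v1)
    (Av2 : intmx R A *m v2 = lA^-1 *: v2)
    (Bv2 : intmx R B *m v2 = lB^-1 *: v2)
    (k : nat) (hk : (1 <= k <= 4)%N) :
  entropy (torus_dist v1 v2) (@toral_action R A B) k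
  = (ln `|lA| + ln `|lB|)%:E.
Proof.
have [[detA _] [detB _]] := (hypA, hypB).
have [[_ lA1] [_ lB1]] := (explA, explB).
exact: (entropy_toral_action basis_v detA detB).
Qed.
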